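(* Let $A_n\in\mathrm{GL}(\mathbb R^d)$ and $Q_n\in\mathrm{GL}(\mathbb R^d)$ for $n\in\mathbb N_0$. Consider the system $u_{n+1}=A_nu_n$, $n\in\mathbb N_0$, and the transformed system $\tilde u_{n+1}=\tilde A_n\tilde u_n$, $\tilde A_n=Q_{n+1}A_nQ_n^{-1}$, $n\in\mathbb N_0$. Let $s\in\{1,\dots,d\}$. (i) Assume $Q_n=r_nQ$, $n\in\mathbb N_0$, with $r_n\in\mathbb R$, $r_n\ne0$ and $Q\in\mathbb R^{d,d}$ orthogonal. Then the angular values of the two systems agree, i.e. each of the eight values $\check\theta_{[s]},\check\theta_s,\hat\theta_s,\hat\theta_{[s]},\underline\theta_{[s]},\underline\theta_s,\bar\theta_s,\bar\theta_{[s]}$ is the same for both systems. (ii) Assume constant transformation matrices $Q_n=Q$, $n\in\mathbb N_0$, with $Q$ invertible. If any one of the values $\theta_s\in\{\check\theta_{[s]},\check\theta_s,\hat\theta_s,\hat\theta_{[s]},\underline\theta_{[s]},\underline\theta_s,\bar\theta_s,\bar\theta_{[s]}\}$ vanishes for the system $u_{n+1}=A_nu_n$, then the same angular value vanishes for the transformed system.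
   Context: $\mathcal G(s,d)$ is the set of $s$-dimensional subspaces of $\mathbb R^d$. For $V,W\in\mathcal G(s,d)$ the principal angles $0\le\phi_1\le\dots\le\phi_s\le\frac\pi2$ and principal vectors $v_j\in V$, $w_j\in W$ are defined recursively by $\cos\phi_j=\max\{v^\top w:v\in V,\ w\in W,\ \|v\|=\|w\|=1,\ v^\top v_\ell=0=w^\top w_\ell\text{ for }\ell<j\}=v_j^\top w_j$; $\measuredangle(V,W)=\phi_s$. For a system $u_{n+1}=A_nu_n$ with invertible $A_n$, $\Phi(n,0)=A_{n-1}\cdots A_0$ for $n\ge1$, $\Phi(0,0)=I$, and $a_{k+1,k+n}(V)=\sum_{j=k+1}^{k+n}\measuredangle(\Phi(j-1,0)V,\Phi(j,0)V)$ for $n\in\mathbb N$, $k\in\mathbb N_0$, $V\in\mathcal G(s,d)$. With suprema over $V\in\mathcal G(s,d)$, its $s$-th angular values are: inner: $\bar\theta_s=\limsup_{n\to\infty}\frac1n\sup_Va_{1,n}(V)$, $\underline\theta_s=\liminf_{n\to\infty}\frac1n\sup_Va_{1,n}(V)$; outer: $\hat\theta_s=\sup_V\limsup_{n\to\infty}\frac1na_{1,n}(V)$, $\check\theta_s=\sup_V\liminf_{n\to\infty}\frac1na_{1,n}(V)$; uniform inner: $\bar\theta_{[s]}=\limsup_{n\to\infty}\frac1n\sup_V\sup_{k\in\mathbb N_0}a_{k+1,k+n}(V)$, $\underline\theta_{[s]}=\liminf_{n\to\infty}\frac1n\sup_V\inf_{k\in\mathbb N_0}a_{k+1,k+n}(V)$;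 uniform outer: $\hat\theta_{[s]}=\sup_V\lim_{n\to\infty}\frac1n\sup_{k\in\mathbb N_0}a_{k+1,k+n}(V)$, $\check\theta_{[s]}=\sup_V\lim_{n\to\infty}\frac1n\inf_{k\in\mathbb N_0}a_{k+1,k+n}(V)$ (the limits exist by Fekete's lemma). *)

(* Defs.v *)
From mathcomp Require Export all_boot all_order all_algebra.
From mathcomp Require Export all_classical all_reals all_analysis.
Export Order.TTheory GRing.Theory Num.Theory.
Export numFieldNormedType.Exports.

Global Set Implicit Arguments.
Global Unset Strict Implicit.
Global Unset Printing Implicit Defensive.

Local Open Scope classical_set_scope.
Local Open Scope ring_scope.

Section AngularValues.
Context {R : realType} {d : nat}.
Implicit Types (V W : {vspace 'cV[R]_d}) (A : nat -> 'M[R]_d) (s n k : nat).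

Definition dotc (x y : 'cV[R]_d) : R := (x^T *m y) ord0 ord0.

(* The library norm on matrices is the sup norm, hence this definition. *)
Definition enorm (x : 'cV[R]_d) : R := Num.sqrt (dotc x x).

Definition orthogonalmx (Q : 'M[R]_d) : Prop := Q^T *m Q = 1%:M.

Definition Grass s : set {vspace 'cV[R]_d} := [set V | \dim V = s].

(* Families indexed by 1, ..., s are functions on nat whose values outside
   that range are never used. *)
Definition admissible V W (v w : nat -> 'cV[R]_d) (j : nat)
    (x y : 'cV[R]_d) : Prop :=
  [/\ x \in V, y \in W, enorm x = 1, enorm y = 1 &
      forall l, (1 <= l < j)%N -> dotc x (v l) = 0 /\ dotc y (w l) = 0].

Definition principal_system s V W (phi : nat -> R) (v w : nat -> 'cV[R]_d) :
    Prop :=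
  (forall i j, (1 <= i <= j)%N -> (j <= s)%N -> phi i <= phi j) /\
  forall j, (1 <= j <= s)%N ->
    [/\ 0 <= phi j <= pi / 2,
        admissible V W v w j (v j) (w j),
        forall x y, admissible V W v w j x y -> dotc x y <= dotc (v j) (w j) &
        cos (phi j) = dotc (v j) (w j)].

(* Between s-dimensional subspaces principal vectors exist but are not unique;
   the principal angles do not depend on their choice, so the choice made by
   [xget] is immaterial and the default value 0 is not reached. *)
Definition angle s V W : R :=
  xget 0 [set t | exists phi v w, principal_system s V W phi v w /\ t = phi s].

Fixpoint Phi A n : 'M[R]_d :=
  if n is n'.+1 then A n' *m Phi A n' else 1%:M.

Definition mximg (B : 'M[R]_d) V : {vspace 'cV[R]_d} :=
  (linfun (mulmx B) @: V)%VS.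

(* [angle_sum A s k n V] is the a_{k+1,k+n}(V) of the system with matrices A. *)
Definition angle_sum A s k n V : R :=
  \sum_(k.+1 <= j < (k + n).+1)
    angle s (mximg (Phi A j.-1) V) (mximg (Phi A j) V).

Local Open Scope ereal_scope.

(* The angular values lie in [0, pi/2]; they are typed in the extended reals so
   that all suprema, infima and upper and lower limits are total.  The index
   n = 0 contributes the irrelevant term 0. *)
Definition invn n : \bar R := (n%:R^-1)%:E.

Definition inner_limsup A s : \bar R :=
  limn_esup (fun n =>
    invn n * ereal_sup [set (angle_sum A s 0 n V)%:E | V in Grass s]).

Definition inner_liminf A s : \bar R :=
  limn_einf (fun n =>
    invn n * ereal_sup [set (angle_sum A s 0 n V)%:E | V in Grass s]).

Definition outer_limsup A s : \bar R :=
  ereal_sup [set limn_esup (fun n => invn n * (angle_sum A s 0 n V)%:E)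
            | V in Grass s].

Definition outer_liminf A s : \bar R :=
  ereal_sup [set limn_einf (fun n => invn n * (angle_sum A s 0 n V)%:E)
            | V in Grass s].

Definition sup_angle_sum A s n V : \bar R :=
  ereal_sup (range (fun k => (angle_sum A s k n V)%:E)).

Definition inf_angle_sum A s n V : \bar R :=
  ereal_inf (range (fun k => (angle_sum A s k n V)%:E)).

Definition unif_inner_limsup A s : \bar R :=
  limn_esup (fun n =>
    invn n * ereal_sup [set sup_angle_sum A s n V | V in Grass s]).

Definition unif_inner_liminf A s : \bar R :=
  limn_einf (fun n =>
    invn n * ereal_sup [set inf_angle_sum A s n V | V in Grass s]).

Definition unif_outer_sup A s : \bar R :=
  ereal_sup [set limn (fun n => invn n * sup_angle_sum A s n V) | V in Grass s].

Definition unif_outer_inf A s : \bar R :=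
  ereal_sup [set limn (fun n => invn n * inf_angle_sum A s n V) | V in Grass s].

End AngularValues.

Definition transformed {R : realType} {d : nat} (Q A : nat -> 'M[R]_d) :
    nat -> 'M[R]_d :=
  fun n => Q n.+1 *m A n *m invmx (Q n).

(* Main.v *)
Require Import Defs.
From mathcomp Require Import lra ring.
Local Open Scope classical_set_scope.
Local Open Scope ring_scope.

(** The solution operators satisfy [Phi~ n = Q_n Phi n Q_0^-1], and nonzero
    scalars do not change subspaces. Hence, when [Q_n = r_n P], the transformed
    orbit of [V] is the image under the fixed matrix [P] of the original orbit of
    [W = Q_0^-1 V], and [V |-> W] permutes the subspaces of dimension [s]. All
    that remains is to compare the angle of two subspaces with the angle of their
    images under [P].

    If [P] is orthogonal, it transports principal systems, so that the angles
    agree ([angle_orthogonal]) and so do all angle sums. If [P] is merely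
    invertible, angles grow at most by a constant factor ([angle_mximg_le]).
    Indeed principal vectors are bi-orthogonal ([principal_cross_lt]), and
    expanding in them shows that [sin (phi s)] is the largest distance to [W] of a
    unit vector of [V] ([principal_near], [principal_far]). Such distances are
    distorted by [P] by at most a factor depending on [P] and its inverse, and an
    angle in [0, pi / 2] is comparable with its sine ([half_le_sin],
    [sin_le_id]). The comparison of angles also uses that principal systems exist
    ([principal_system_exists]), by compactness.

    Finally each of the eight angular values is nonnegative, monotone and
    positively homogeneous in the angle sums (the lemmas with suffix [_leZ]), so
    an angular value of the transformed system is at most [c] times the original
    one. With [c = 1] in both directions this gives equality for orthogonal [P],
    and in general it preserves vanishing. The uniform outer values are defined by
    limits; Fekete's lemma ([fekete]) makes them upper or lower limits, for which
    monotonicity holds. *)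

(** * Euclidean geometry of column vectors *)

Section dot_product.
Context {R : realType} {d : nat}.
Implicit Types (x y z : 'cV[R]_d) (a : R) (P : 'M[R]_d) (V W : {vspace 'cV[R]_d}).

Lemma dotcE x y : dotc x y = \sum_i x i 0 * y i 0.
Proof. by rewrite /dotc mxE; apply: eq_bigr => i _; rewrite mxE. Qed.

Lemma dotcC x y : dotc x y = dotc y x.
Proof. by rewrite !dotcE; apply: eq_bigr => i _; rewrite mulrC. Qed.

Lemma dotcDl x y z : dotc (x + y) z = dotc x z + dotc y z.
Proof. by rewrite /dotc linearD/= mulmxDl mxE. Qed.

Lemma dotcDr x y z : dotc z (x + y) = dotc z x + dotc z y.
Proof. by rewrite dotcC dotcDl !(dotcC z). Qed.

Lemma dotcZl a x z : dotc (a *: x) z = a * dotc x z.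
Proof. by rewrite /dotc linearZ/= -scalemxAl mxE. Qed.

Lemma dotcZr a x z : dotc z (a *: x) = a * dotc z x.
Proof. by rewrite dotcC dotcZl (dotcC z). Qed.

Lemma dotcNl x z : dotc (- x) z = - dotc x z.
Proof. by rewrite -scaleN1r dotcZl mulN1r. Qed.

Lemma dotcNr x z : dotc z (- x) = - dotc z x.
Proof. by rewrite dotcC dotcNl (dotcC z). Qed.

Lemma dotc0l z : dotc 0 z = 0.
Proof. by rewrite -(scale0r 0) dotcZl mul0r. Qed.

Lemma dotcBB x y : dotc (x - y) (x - y) = dotc x x - 2 * dotc x y + dotc y y.
Proof.
rewrite !(dotcDl, dotcDr, dotcNl, dotcNr) (dotcC y x); ring.
Qed.

Lemma dotc_suml n (e : 'I_n -> 'cV[R]_d) z :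
  dotc (\sum_i e i) z = \sum_i dotc (e i) z.
Proof.
by elim/big_rec2: _ => [|i a y _ <-]; rewrite ?dotc0l// dotcDl.
Qed.

Lemma dotc_ge0 x : 0 <= dotc x x.
Proof. by rewrite dotcE sumr_ge0// => i _; rewrite -expr2 sqr_ge0. Qed.

Lemma dotc_eq0 x : dotc x x = 0 -> x = 0.
Proof.
rewrite dotcE => /eqP; rewrite psumr_eq0 => [/allP h|i _]; last first.
  by rewrite -expr2 sqr_ge0.
apply/colP => i; rewrite mxE; apply/eqP.
by have := h i (mem_index_enum i); rewrite /= mulf_eq0 orbb.
Qed.

Lemma enorm1 x : enorm x = 1 <-> dotc x x = 1.
Proof.
rewrite /enorm; split => [h|->]; last exact: sqrtr1.
by rewrite -(sqr_sqrtr (dotc_ge0 x)) h expr1n.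
Qed.

Lemma dotc_CS x y : dotc x y ^+ 2 <= dotc x x * dotc y y.
Proof.
have [/dotc_eq0 ->|y0] := eqVneq (dotc y y) 0.
  by rewrite dotcC !dotc0l expr0n mulr0.
have yp : 0 < dotc y y by rewrite lt0r y0 dotc_ge0.
have := dotc_ge0 (dotc y y *: x - dotc x y *: y).
rewrite !(dotcDl, dotcDr, dotcNl, dotcNr, dotcZl, dotcZr) (dotcC y x) => h.
rewrite -subr_ge0 -(pmulr_rge0 _ yp).
by apply: le_trans h _; rewrite le_eqVlt; apply/orP; left; apply/eqP; ring.
Qed.

Lemma mulmx_bounded P : exists2 K : R, 0 < K &
  forall x, dotc (P *m x) (P *m x) <= K * dotc x x.
Proof.
exists (1 + \sum_i dotc (row i P)^T (row i P)^T) => [|x].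
  by rewrite ltr_wpDr// sumr_ge0// => i _; exact: dotc_ge0.
rewrite mulrDl mul1r ler_wpDl ?dotc_ge0// mulr_suml dotcE ler_sum// => i _.
have -> : (P *m x) i 0 = dotc (row i P)^T x.
  by rewrite dotcE mxE; apply: eq_bigr => j _; rewrite !mxE.
by rewrite -expr2 dotc_CS.
Qed.

(** A subspace is cut out by finitely many linear equations, namely the
    coordinates of [x - projv V x = 0]. *)
Lemma mem_vspace_dotc V : exists u : 'I_d -> 'cV[R]_d,
  forall x, x \in V <-> forall k, dotc (u k) x = 0.
Proof.
exists (fun k => \col_i (delta_mx i 0 - projv V (delta_mx i 0)) k 0) => x.
have h k : dotc (\col_i (delta_mx i 0 - projv V (delta_mx i 0)) k 0) x
         = (x - projv V x) k 0.
  rewrite [in RHS](matrix_sum_delta x) linear_sum/= -sumrB summxE dotcE.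
  apply: eq_bigr => i _; rewrite big_ord1 linearZ/= -scalerBr mxE mulrC.
  by rewrite [RHS]mxE.
split => [xV k|xV]; first by rewrite h projv_id// subrr mxE.
suff -> : x = projv V x by exact: memv_proj.
by apply/eqP; rewrite -subr_eq0; apply/eqP/colP => k; rewrite -h xV mxE.
Qed.

(** A subspace of dimension larger than [m] contains a unit vector orthogonal to
    [m] given vectors, because the map [x |-> (dotc x (e l))_l] into an
    [m]-dimensional space has a nontrivial kernel on it. *)
Lemma exists_unit_orthogonal V m (e : nat -> 'cV[R]_d) :
  (m < \dim V)%N -> exists x, [/\ x \in V, dotc x x = 1 &
    forall l, (l < m)%N -> dotc x (e l) = 0].
Proof.
move=> mV.
pose f := linfun (mulmx (\matrix_(i < m) (e i)^T)) : 'Hom('cV[R]_d, 'cV[R]_m).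
have : (0 < \dim (V :&: lker f))%N.
  have := limg_ker_dim f V; have := dimvS (subvf (f @: V)%VS).
  rewrite dimvf/= /dim/= muln1 => h1 h2; rewrite lt0n; apply/eqP => h3.
  by move: mV; rewrite -h2 h3 add0n ltnNge h1.
rewrite lt0n dimv_eq0 => /eqP V0.
have [x] : exists2 x, x \in (V :&: lker f)%VS & x != 0.
  exists (vpick (V :&: lker f)); first exact: memv_pick.
  by rewrite vpick0; apply/eqP.
rewrite memv_cap memv_ker => /andP[xV]; rewrite lfunE/= => /eqP fx x0.
have xp : 0 < dotc x x.
  rewrite lt0r dotc_ge0 andbT; apply: contra_neq x0; exact: dotc_eq0.
exists ((Num.sqrt (dotc x x))^-1 *: x); split.
- exact: memvZ.
- rewrite dotcZl dotcZr mulrA -expr2 exprVn sqr_sqrtr ?dotc_ge0// mulVf//.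
  by rewrite gt_eqF.
- move=> l lm; rewrite dotcZl; apply/eqP; rewrite mulf_eq0; apply/orP; right.
  move/colP/(_ (Ordinal lm)): fx; rewrite !mxE dotcC dotcE => fx.
  apply/eqP; rewrite -[RHS]fx; apply: eq_bigr => i _.
  by rewrite !mxE.
Qed.

(** Expansion of a vector in an orthonormal family of the right cardinality. *)
Lemma orthonormal_expand V n (e : 'I_n -> 'cV[R]_d) :
  \dim V = n -> (forall i, e i \in V) ->
  (forall i j, dotc (e i) (e j) = (i == j)%:R) ->
  forall x, x \in V -> x = \sum_i dotc x (e i) *: e i.
Proof.
move=> dV eV eo x xV.
have co (k : 'I_n -> R) j : dotc (\sum_i k i *: e i) (e j) = k j.
  rewrite dotc_suml (bigD1 j)//= dotcZl eo eqxx mulr1 big1 ?addr0// => i ij.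
  by rewrite dotcZl eo (negbTE ij) mulr0.
pose X := [tuple e i | i < n].
have XE (i : 'I_n) : X`_i = e i by rewrite -tnth_nth tnth_mktuple.
have Xb : basis_of V X.
  rewrite basisEfree size_tuple dV leqnn andbT; apply/andP; split.
    apply/freeP => k k0 i; rewrite -(co k); under eq_bigr do rewrite -XE.
    by rewrite k0 dotc0l.
  by apply/span_subvP => y /tnthP[i ->]; rewrite tnth_mktuple.
rewrite [LHS](coord_basis Xb xV); apply: eq_bigr => i _; rewrite XE.
congr (_ *: _).
rewrite [in RHS](coord_basis Xb xV) -[LHS](co (fun i => coord X i x)).
by congr dotc; apply: eq_bigr => j _; rewrite XE.
Qed.

End dot_product.

(** * Principal systems *)

Section principal_systems.
Context {R : realType} {d : nat}.
Implicit Types (x y : 'cV[R]_d) (V W : {vspace 'cV[R]_d}) (v w : nat -> 'cV[R]_d).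

Lemma admissible_sym V W v w j x y :
  admissible V W v w j x y -> admissible W V w v j y x.
Proof. by case=> ? ? ? ? o; split => // l /o[]. Qed.

Lemma admissible_ext V W v w v' w' j x y :
  (forall l, (1 <= l < j)%N -> v l = v' l /\ w l = w' l) ->
  admissible V W v w j x y -> admissible V W v' w' j x y.
Proof.
by move=> h [? ? ? ? o]; split => // l lj; have [<- <-] := h l lj; exact: o.
Qed.

Lemma principal_system_sym s V W phi v w :
  principal_system s V W phi v w -> principal_system s W V phi w v.
Proof.
move=> [mono H]; split => // j /H[? a m c]; split => //.
- exact: admissible_sym.
- by move=> x y /admissible_sym/m; rewrite dotcC (dotcC (w j)).
- by rewrite dotcC.
Qed.

Section orthogonality.
Variables (s : nat) (V W : {vspace 'cV[R]_d}) (phi : nat -> R).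
Variables (v w : nat -> 'cV[R]_d).
Hypothesis H : principal_system s V W phi v w.

(** Every pair of principal vectors of index at least [i] competes in the
    maximisation that selects [v i] and [w i]. *)
Lemma principal_admissible i j k :
  (1 <= i <= j)%N -> (i <= k)%N -> (j <= s)%N -> (k <= s)%N ->
  admissible V W v w i (v j) (w k).
Proof.
case: H => _ PS /andP[i1 ij] ik js ks.
have [|_ [vV _ v1 _ vo] _ _] := PS j; first by rewrite (leq_trans i1 ij).
have [|_ [_ wW _ w1 wo] _ _] := PS k; first by rewrite (leq_trans i1 ik).
split => // l /andP[l1 li]; split.
- by have [|->] := vo l; rewrite ?l1 ?(leq_trans li).
- by have [|_ ->] := wo l; rewrite ?l1 ?(leq_trans li).
Qed.

Lemma principal_admissible_diag i :
  (1 <= i <= s)%N -> admissible V W v w i (v i) (w i).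
Proof. by case: H => _ PS /PS[]. Qed.

Lemma principal_orthonormal i j : (1 <= i <= s)%N -> (1 <= j <= s)%N ->
  dotc (v i) (v j) = (i == j)%:R.
Proof.
wlog ij : i j / (i <= j)%N.
  move=> h hi hj; have [|/ltnW] := leqP i j => ij; first exact: h.
  by rewrite dotcC eq_sym h.
move=> /andP[i1 si] /andP[j1 js].
have [|_ _ /enorm1 v1 _ vo] := @principal_admissible_diag j; first by rewrite j1.
have [->|nij] := eqVneq i j; first exact: v1.
by rewrite dotcC; have [|-> _] := vo i; rewrite ?i1// ltn_neqAle nij.
Qed.

Lemma principal_cos_ge0 i : (1 <= i <= s)%N -> 0 <= dotc (v i) (w i).
Proof.
case: H => _ PS /PS[/andP[p0 p2] _ _ <-]; apply: cos_ge0_pihalf.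
by rewrite p2 andbT (le_trans _ p0)// oppr_le0 divr_ge0 ?pi_ge0.
Qed.

(** Bi-orthogonality of principal vectors. With [c = dotc (v i) (w i)] and
    [b = dotc (v i) (w j)], the unit vector of [W] proportional to
    [c w_i + b w_j] competes at stage [i] against [w i] and has scalar product
    [sqrt (c ^ 2 + b ^ 2)] with [v i]; maximality of [c] forces [b = 0]. *)
Lemma principal_cross_lt i j : (1 <= i)%N -> (i < j)%N -> (j <= s)%N ->
  dotc (v i) (w j) = 0.
Proof.
move=> i1 ij js; set b := dotc _ _.
have si : (i <= s)%N := leq_trans (ltnW ij) js.
have c0 : 0 <= dotc (v i) (w i) by apply: principal_cos_ge0; rewrite i1.
have [|_ _ max _] := H.2 i; first by rewrite i1.
set c := dotc (v i) (w i) in c0 max.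
have [aV wiW v1 /enorm1 wi1 oi] : admissible V W v w i (v i) (w i).
  by apply: principal_admissible; rewrite ?i1 ?leqnn.
have [_ wjW _ /enorm1 wj1 oj] : admissible V W v w i (v i) (w j).
  by apply: principal_admissible; rewrite ?i1 ?leqnn// ltnW.
have wij : dotc (w i) (w j) = 0.
  have [|_ _ _ _ o] := @principal_admissible_diag j.
    by rewrite (leq_trans i1 (ltnW ij)).
  by rewrite dotcC; have [|_ ->] := o i; rewrite ?i1.
have [->//|b0] := eqVneq b 0; exfalso.
pose r := Num.sqrt (c ^+ 2 + b ^+ 2).
have q0 : 0 < c ^+ 2 + b ^+ 2.
  by rewrite ltr_wpDl ?sqr_ge0// lt0r sqr_ge0 andbT sqrf_eq0.
have r0 : 0 < r by rewrite sqrtr_gt0.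
have r2 : r ^+ 2 = c ^+ 2 + b ^+ 2 by rewrite sqr_sqrtr// ltW.
have : dotc (v i) (r^-1 *: (c *: w i + b *: w j)) <= c.
  apply: max; split => //.
  - by rewrite memvZ// memvD// memvZ.
  - apply/enorm1; rewrite !(dotcDl, dotcDr, dotcZl, dotcZr).
    rewrite wi1 wj1 (dotcC (w j)) wij !mulr0 addr0 add0r !mulr1.
    rewrite (_ : _ * _ = r ^- 2 * (c ^+ 2 + b ^+ 2)); last first.
      by field; rewrite gt_eqF.
    by rewrite -r2 mulVf// expf_neq0// gt_eqF.
  - move=> l /[dup] /oi[vl wil] /oj[_ wjl]; split => //.
    by rewrite dotcZl dotcDl !dotcZl wil wjl !mulr0 addr0 mulr0.
rewrite dotcZr dotcDr !dotcZr -/c -/b -!expr2 -r2 expr2 mulKf ?gt_eqF// => rc.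
have : r ^+ 2 <= c ^+ 2 by rewrite lerXn2r// nnegrE ltW.
by rewrite r2 gerDl leNgt lt0r sqr_ge0 andbT sqrf_eq0 b0.
Qed.

End orthogonality.

Section expansion.
Variables (s : nat) (V W : {vspace 'cV[R]_d}) (phi : nat -> R).
Variables (v w : nat -> 'cV[R]_d).
Hypotheses (H : principal_system s V W phi v w) (dV : \dim V = s).

Let sH := principal_system_sym H.

Let ordS (i : 'I_s) : (1 <= i.+1 <= s)%N. Proof. exact: ltn_ord. Qed.

Lemma principal_cross i j : (1 <= i <= s)%N -> (1 <= j <= s)%N -> i != j ->
  dotc (v i) (w j) = 0.
Proof.
move=> /andP[i1 si] /andP[j1 js]; rewrite neq_ltn => /orP[ij|ji].
  exact: (principal_cross_lt H).
by rewrite dotcC; exact: (principal_cross_lt sH).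
Qed.

Lemma principal_expand x : x \in V ->
  x = \sum_(i < s) dotc x (v i.+1) *: v i.+1.
Proof.
apply: (@orthonormal_expand _ _ _ _ (fun i : 'I_s => v i.+1)) => //.
- move=> i; by have [] := principal_admissible_diag H (ordS i).
- by move=> i j; rewrite (principal_orthonormal H)// eqSS.
Qed.

End expansion.

Section distance.
Variables (s : nat) (V W : {vspace 'cV[R]_d}) (phi : nat -> R).
Variables (v w : nat -> 'cV[R]_d).
Hypotheses (H : principal_system s V W phi v w) (s0 : (0 < s)%N).
Hypotheses (dV : \dim V = s) (dW : \dim W = s).

Let sH := principal_system_sym H.

Let ordS (i : 'I_s) : (1 <= i.+1 <= s)%N. Proof. exact: ltn_ord. Qed.

Lemma principal_sin_le i : (1 <= i <= s)%N ->
  1 - dotc (v i) (w i) ^+ 2 <= sin (phi s) ^+ 2.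
Proof.
move=> /[dup] iH /andP[i1 si]; have [mono PS] := H.
have ss : (1 <= s <= s)%N by rewrite s0 leqnn.
have [/andP[pi0 pi2] _ _ <-] := PS _ iH.
have [/andP[ps0 ps2] _ _ _] := PS _ ss.
rewrite -sin2cos2.
have p2pi : pi / 2 <= pi :> R by have := pi_ge0 R; lra.
have h t : 0 <= t -> t <= pi / 2 -> 0 <= sin t :> R.
  by move=> t0 t2; apply: sin_ge0_pi; rewrite t0 (le_trans t2).
rewrite lerXn2r ?nnegrE ?h//.
have [e|n] := eqVneq i s; first by rewrite e.
have := mono i s; rewrite i1 si leqnn => /(_ isT isT).
rewrite le_eqVlt => /orP[/eqP ->//|l].
by apply/ltW; rewrite ltr_sin// in_itv/=; apply/andP; split; lra.
Qed.

(** Every [x] in [V] lies within [sin (phi s) * |x|] of [W]: the vector of [W]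
    with coordinates [a_i c_i] in the basis [w i] realises this bound, where [a_i] are the
    coordinates of [x] in the basis [v i] and [c_i] the cosines of the principal angles. *)
Lemma principal_near x : x \in V -> exists2 y, y \in W &
  dotc (x - y) (x - y) <= sin (phi s) ^+ 2 * dotc x x.
Proof.
move=> xV.
have xE := principal_expand H dV xV.
(* Principal vectors are numbered from 1, ordinals from 0. *)
pose a (i : 'I_s) := dotc x (v i.+1).
pose c (i : 'I_s) := dotc (v i.+1) (w i.+1).
pose y := \sum_i (a i * c i) *: w i.+1.
have wW i : (1 <= i <= s)%N -> w i \in W.
  by move=> /(principal_admissible_diag H)[].
have vy (i : 'I_s) : dotc (v i.+1) y = a i * c i ^+ 2.
  rewrite dotcC dotc_suml (bigD1 i)//= big1 ?addr0 => [|j ji].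
    by rewrite dotcZl dotcC -/(c i) expr2 mulrA.
  by rewrite dotcZl dotcC (principal_cross H) ?mulr0// eqSS eq_sym.
have wy (i : 'I_s) : dotc (w i.+1) y = a i * c i.
  rewrite dotcC dotc_suml (bigD1 i)//= big1 ?addr0 => [|j ji].
    by rewrite dotcZl (principal_orthonormal sH)// eqxx mulr1.
  by rewrite dotcZl (principal_orthonormal sH)// eqSS val_eqE (negbTE ji) mulr0.
have xx : dotc x x = \sum_i a i ^+ 2.
  rewrite {1}xE dotc_suml; apply: eq_bigr => i _.
  by rewrite dotcZl (dotcC _ x) expr2.
have xy : dotc x y = \sum_i a i ^+ 2 * c i ^+ 2.
  rewrite {1}xE dotc_suml; apply: eq_bigr => i _.
  by rewrite dotcZl vy mulrA -expr2.
have yy : dotc y y = \sum_i a i ^+ 2 * c i ^+ 2.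
  rewrite {1}/y dotc_suml; apply: eq_bigr => i _.
  by rewrite dotcZl wy; ring.
exists y; first by rewrite memv_suml// => i _; rewrite memvZ// wW.
have -> : dotc (x - y) (x - y) = \sum_i a i ^+ 2 * (1 - c i ^+ 2).
  under eq_bigr do rewrite mulrBr mulr1.
  by rewrite sumrB dotcBB xx xy yy; ring.
rewrite xx mulr_sumr ler_sum// => i _; rewrite mulrC.
by rewrite ler_wpM2r ?sqr_ge0// principal_sin_le.
Qed.

(** The vector [v s] is at distance at least [sin (phi s)] from [W]. *)
Lemma principal_far y : y \in W ->
  sin (phi s) ^+ 2 <= dotc (v s - y) (v s - y).
Proof.
move=> yW; have [mono PS] := H.
have ss : (1 <= s <= s)%N by rewrite s0 leqnn.
have [_ [_ _ /enorm1 v1 /enorm1 w1 _] _ cE] := PS _ ss.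
have vy : dotc (v s) y = dotc y (w s) * dotc (v s) (w s).
  rewrite {1}(principal_expand sH dW yW) dotcC dotc_suml.
  have i0P : (s.-1 < s)%N by rewrite prednK.
  rewrite (bigD1 (Ordinal i0P))//= prednK// big1 ?addr0 => [|j ji].
    by rewrite dotcZl (dotcC (w s)).
  rewrite dotcZl (dotcC (w _)) (principal_cross H) ?mulr0//.
  by apply: contraNneq ji => e; apply/eqP/val_inj; rewrite /= -[LHS]/(j.+1.-1) -e.
have := dotc_CS y (w s); rewrite w1 mulr1 dotcBB v1 vy sin2cos2 cE.
set b := dotc y (w s); set c := dotc (v s) (w s) => h.
have := sqr_ge0 (b - c); rewrite sqrrB; lra.
Qed.

End distance.

Lemma dotc_continuous (T : topologicalType) (f g : T -> 'rV[R]_d) :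
  continuous f -> continuous g -> continuous (fun t => dotc (f t)^T (g t)^T).
Proof.
move=> cf cg.
under eq_fun do rewrite dotcE; move=> t.
apply: (@cvg_big _ _ +%R 0 predT _ _ _ _ _ _ _ _); first exact: add_continuous.
move=> i _; under eq_fun do rewrite !mxE; rewrite !mxE.
have coord (h : T -> 'rV[R]_d) : continuous h -> continuous (fun r => h r 0 i).
  move=> ch r; apply: (@continuous_comp _ _ _ h (fun M : 'rV[R]_d => M 0 i)).
    exact: ch.
  exact: coord_continuous.
by apply: cvgM; exact: coord.
Qed.

Lemma compact_cube :
  compact [set a : 'rV[R]_d | forall i, [set` `[(-1 : R), 1]] (a ord0 i)].
Proof.
apply: (@rV_compact _ _ (fun=> `[(-1 : R), 1]%classic)) => i.
exact: segment_compact.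
Qed.

Lemma closed_level (T : topologicalType) (f : T -> R) a :
  continuous f -> closed [set t | f t = a].
Proof.
by move=> cf; apply: (@preimage_closed _ _ f [set a]) => // ? _; exact: cf.
Qed.

Lemma closed_levels (T : topologicalType) (I : Type) (D : set I)
    (f : I -> T -> R) :
  (forall i, continuous (f i)) -> closed [set t | forall i, D i -> f i t = 0].
Proof.
move=> cf.
rewrite (_ : [set _ | _] = \bigcap_(i in D) [set t | f i t = 0]) //.
by apply: closed_bigI => i _; exact: closed_level.
Qed.

(** The admissible pairs form a closed subset of a product of two cubes, hence a
    compact set, on which the scalar product attains its maximum. *)
Lemma admissible_max V W v w j x0 y0 : admissible V W v w j x0 y0 ->
  exists x y, admissible V W v w j x y /\
    forall x' y', admissible V W v w j x' y' -> dotc x' y' <= dotc x y.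
Proof.
move=> adm0.
pose D := [set p : 'rV[R]_d * 'rV[R]_d | admissible V W v w j p.1^T p.2^T].
have cfst : continuous (fst : 'rV[R]_d * 'rV[R]_d -> _) by move=> p; exact: cvg_fst.
have csnd : continuous (snd : 'rV[R]_d * 'rV[R]_d -> _) by move=> p; exact: cvg_snd.
have c1 (u : 'cV[R]_d) : continuous (fun p : 'rV[R]_d * 'rV[R]_d => dotc p.1^T u).
  rewrite -(trmxK u); apply: dotc_continuous; first exact: cfst.
  exact: cst_continuous.
have c2 (u : 'cV[R]_d) : continuous (fun p : 'rV[R]_d * 'rV[R]_d => dotc p.2^T u).
  rewrite -(trmxK u); apply: dotc_continuous; first exact: csnd.
  exact: cst_continuous.
have [u uV] := mem_vspace_dotc V.
have [u' uW] := mem_vspace_dotc W.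
have Dcl : closed D.
  rewrite (_ : D =
    [set p | forall k, setT k -> dotc p.1^T (u k) = 0] `&`
    [set p | forall k, setT k -> dotc p.2^T (u' k) = 0] `&`
    [set p | dotc p.1^T p.1^T = 1] `&` [set p | dotc p.2^T p.2^T = 1] `&`
    [set p | forall l, [set l | (1 <= l < j)%N] l -> dotc p.1^T (v l) = 0] `&`
    [set p | forall l, [set l | (1 <= l < j)%N] l -> dotc p.2^T (w l) = 0]).
    repeat apply: closedI.
    - by apply: closed_levels => k; exact: c1.
    - by apply: closed_levels => k; exact: c2.
    - by apply: closed_level; exact: (dotc_continuous cfst cfst).
    - by apply: closed_level; exact: (dotc_continuous csnd csnd).
    - by apply: closed_levels => k; exact: c1.
    - by apply: closed_levels => k; exact: c2.
  apply/seteqP; split => [p [/uV h1 /uW h2 /enorm1 h3 /enorm1 h4 h5]|p].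
    split; last by move=> l /h5[].
    split; last by move=> l /h5[].
    by do !split => //; move=> k _; rewrite dotcC.
  move=> [[[[[h1 h2] h3] h4] h5] h6]; split.
  - by apply/uV => k; rewrite dotcC h1.
  - by apply/uW => k; rewrite dotcC h2.
  - exact/enorm1.
  - exact/enorm1.
  - by move=> l hl; split; [exact: h5|exact: h6].
pose B := [set a : 'rV[R]_d | forall i, [set` `[(-1 : R), 1]] (a ord0 i)].
have Bco : compact B := compact_cube.
have B1 (a : 'rV[R]_d) : enorm a^T = 1 -> B a.
  move=> /enorm1; rewrite dotcE => a1 i /=; rewrite in_itv/= -ler_norml.
  rewrite -(@expr_le1 _ 2)// -normrX ger0_norm ?sqr_ge0// -a1 (bigD1 i)//=.
  by rewrite !mxE -expr2 lerDl sumr_ge0// => k _; rewrite -expr2 sqr_ge0.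
have Dco : compact D.
  apply: (subclosed_compact Dcl (compact_setX Bco Bco)).
  by move=> p [_ _ h1 h2 _]; split; exact: B1.
have D0 : D !=set0 by exists (x0^T, y0^T); rewrite /D/= !trmxK.
have [[a b] + max] := compact_EVT_max D0 Dco
  (continuous_subspaceT (dotc_continuous cfst csnd)).
rewrite inE => Dab; exists a^T, b^T; split => // x y xy.
by have := max (x^T, y^T); rewrite inE /D/= !trmxK; exact.
Qed.

(** The first [j] principal pairs exist, by induction on [j]: admissibility at a
    stage only involves the vectors of earlier stages, so later vectors may be
    chosen without disturbing earlier ones. *)
Lemma principal_vectors_exist s V W : \dim V = s -> \dim W = s ->
  forall j, (j <= s)%N -> exists v w, forall i, (1 <= i <= j)%N ->
    admissible V W v w i (v i) (w i) /\
    forall x y, admissible V W v w i x y -> dotc x y <= dotc (v i) (w i).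
Proof.
move=> dV dW; elim=> [|j IH] js.
  by exists (fun=> 0), (fun=> 0) => i; case: i.
have [v [w vw]] := IH (ltnW js).
have [|x0 [x0V x01 x0o]] := @exists_unit_orthogonal _ _ V j (fun l => v l.+1).
  by rewrite dV.
have [|y0 [y0W y01 y0o]] := @exists_unit_orthogonal _ _ W j (fun l => w l.+1).
  by rewrite dW.
have [|x [y [xy max]]] := @admissible_max V W v w j.+1 x0 y0.
  split => //; [exact/enorm1|exact/enorm1|case=> [//|l] /andP[_ lj]].
  by split; [exact: x0o|exact: y0o].
pose v' l := if l == j.+1 then x else v l.
pose w' l := if l == j.+1 then y else w l.
have ext i : (i <= j.+1)%N -> forall l, (1 <= l < i)%N -> v l = v' l /\ w l = w' l.
  move=> ij l /andP[_ li]; rewrite /v' /w'.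
  have /negbTE-> : l != j.+1 by rewrite neq_ltn (leq_trans li).
  by [].
have tse i : (i <= j.+1)%N -> forall l, (1 <= l < i)%N -> v' l = v l /\ w' l = w l.
  by move=> ij l li; have [-> ->] := ext i ij l li.
exists v', w' => i /andP[i1 ij].
have [adm mx] : admissible V W v w i (v' i) (w' i) /\
    forall x y, admissible V W v w i x y -> dotc x y <= dotc (v' i) (w' i).
  rewrite /v' /w'; have [->//|nij] := eqVneq i j.+1.
  by apply: vw; rewrite i1 -ltnS ltn_neqAle nij.
split; first exact: admissible_ext (ext _ ij) adm.
by move=> ? ? /(admissible_ext (tse _ ij)); exact: mx.
Qed.

Lemma principal_system_exists s V W : \dim V = s -> \dim W = s ->
  exists phi v w, principal_system s V W phi v w.
Proof.
move=> dV dW; have [v [w vw]] := principal_vectors_exist dV dW (leqnn s).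
pose c j := dotc (v j) (w j).
have c0 j : (1 <= j <= s)%N -> 0 <= c j.
  move=> /vw[adm max].
  (* The pair (- v j, w j) is admissible as well. *)
  have : - c j <= c j.
    rewrite -dotcNl; apply: max; case: adm => vV wW /enorm1 v1 w1 o; split => //.
    - by rewrite memvN.
    - by apply/enorm1; rewrite dotcNl dotcNr opprK.
    - by move=> l /o[vl wl]; rewrite dotcNl vl oppr0.
  lra.
have c1 j : (1 <= j <= s)%N -> c j <= 1.
  move=> /vw[[_ _ /enorm1 v1 /enorm1 w1 _] _].
  have := dotc_CS (v j) (w j); rewrite v1 w1 mulr1 -/(c j) => h.
  apply: le_trans (ler_norm _) _.
  by rewrite -(@expr_le1 _ 2)// -normrX ger0_norm ?sqr_ge0.
have cI j : (1 <= j <= s)%N -> -1 <= c j <= 1.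
  by move=> js; rewrite c1// andbT (le_trans _ (c0 _ js)).
have acos_mono (a b : R) :
    -1 <= a <= 1 -> -1 <= b <= 1 -> a <= b -> acos b <= acos a.
  move=> aI bI ab; rewrite leNgt; apply/negP => l.
  have : cos (acos b) < cos (acos a).
    by rewrite ltr_cos// in_itv/= acos_ge0// acos_lepi.
  by rewrite !acosK ?in_itv//= ltNge ab.
exists (fun j => acos (c j)), v, w; split => [i j /andP[i1 ij] js|j js].
  have iI : (1 <= i <= s)%N by rewrite i1 (leq_trans ij).
  have jI : (1 <= j <= s)%N by rewrite js (leq_trans i1 ij).
  apply: acos_mono; [exact: cI|exact: cI|].
  have [_ max] := vw i iI; apply: max.
  have [[vV _ v1 _ vo] _] := vw j jI.
  have [[_ wW _ w1 wo] _] := vw j jI.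
  by split => // l /andP[l1 li]; split;
    [have [] := vo l|have [] := wo l]; rewrite ?l1 ?(leq_trans li).
have [adm max] := vw j js; split => //; last by rewrite acosK// in_itv/= cI.
rewrite acos_ge0 ?cI//= -acos0.
by apply: acos_mono; [rewrite lerN10 ler01|exact: cI|exact: c0].
Qed.

(** For equidimensional subspaces the default value in the definition of [angle]
    is not used. *)
Lemma angleP s V W : \dim V = s -> \dim W = s ->
  exists phi v w, principal_system s V W phi v w /\ angle s V W = phi s.
Proof.
move=> dV dW; rewrite /angle; case: xgetP => [t _ [phi [v [w [H ->]]]]|no].
  by exists phi, v, w.
have [phi [v [w H]]] := principal_system_exists dV dW.
by have := no (phi s); case; exists phi, v, w.
Qed.

End principal_systems.

(** * Comparison of an angle with its sine *)

Section sine.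
Context {R : realType}.

Lemma sin_MVT (t : R) : 0 <= t -> exists2 c, 0 <= c <= t & sin t = cos c * t.
Proof.
move=> t0.
have [|c] := @MVT_segment R sin cos 0 t t0 (fun r _ => is_derive_sin r).
  by apply: continuous_subspaceT; exact: continuous_sin.
by rewrite in_itv/= sin0 !subr0 => ct ->; exists c.
Qed.

Lemma sin_le_id (t : R) : 0 <= t -> sin t <= t.
Proof.
move=> t0; have [c _ ->] := sin_MVT t0.
by rewrite -[leRHS]mul1r ler_wpM2r// cos_le1.
Qed.

(** On [0, pi / 2], write [sin t = 2 sin (t / 2) cos (t / 2)] and bound
    [sin (t / 2)] below by [(t / 2) cos (pi / 4)] and [cos (t / 2)] by [cos (pi / 4)]. *)
Lemma half_le_sin (t : R) : 0 <= t <= pi / 2 -> t / 2 <= sin t.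
Proof.
move=> /andP[t0 t2].
have u0 : 0 <= t / 2 by lra.
have [c /andP[c0 ct] su] := sin_MVT u0.
have pp := pi_gt0 R.
have q0 : 0 < cos (pi / 4) :> R.
  by apply: cos_gt0_pihalf; apply/andP; split; lra.
have q2 : 2 * cos (pi / 4) ^+ 2 = 1 :> R.
  have := @cos_mulr2n R (pi / 4).
  have -> : (pi / 4) *+ 2 = pi / 2 :> R by rewrite mulr2n; field.
  by rewrite cos_pihalf mulr2n; lra.
have cge (r : R) : 0 <= r -> r <= t / 2 -> cos (pi / 4) <= cos r.
  move=> x0 xt; have [->//|n] := eqVneq r (pi / 4).
  have xl : r < pi / 4 by rewrite lt_neqAle n; lra.
  by apply/ltW; rewrite ltr_cos// in_itv/=; apply/andP; split; lra.
have -> : t = (t / 2) *+ 2 by rewrite mulr2n; field.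
rewrite sin_mulr2n su.
have -> : t / 2 *+ 2 / 2 = t / 2 :> R by rewrite mulr2n; field.
have h : cos (pi / 4) ^+ 2 <= cos (t / 2) * cos c.
  by rewrite expr2 ler_pM ?cge// ltW.
have e : t / 2 * (2 * cos (pi / 4) ^+ 2) = t / 2 by rewrite q2 mulr1.
have := ler_wpM2l u0 h.
move: e; set a := t / 2; set p := cos _; set q := cos a; set r := cos c.
move=> e h'; have {}h' : a * p ^+ 2 <= a * (q * r) by [].
have -> : q * (r * a) *+ 2 = a * (q * r) + a * (q * r) by ring.
have e' : a = a * p ^+ 2 + a * p ^+ 2 by rewrite -{1}e; ring.
by rewrite {1}e' lerD.
Qed.

End sine.

(** * Angles between images of subspaces *)

Section images.
Context {R : realType} {d : nat}.
Implicit Types (x y : 'cV[R]_d) (V W : {vspace 'cV[R]_d}) (B C P : 'M[R]_d).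

Lemma mem_mximg B V x : x \in V -> B *m x \in mximg B V.
Proof. by move=> xV; apply/memv_imgP; exists x => //; rewrite lfunE. Qed.

Lemma mximgP B V x : x \in mximg B V -> exists2 y, y \in V & x = B *m y.
Proof. by move=> /memv_imgP[y yV ->]; exists y; rewrite ?lfunE. Qed.

Lemma mximgM B C V : mximg (B *m C) V = mximg B (mximg C V).
Proof.
rewrite /mximg -limg_comp; congr (_ @: V)%VS.
by apply/lfunP => x; rewrite comp_lfunE !lfunE/= mulmxA.
Qed.

Lemma mximg1 V : mximg 1%:M V = V.
Proof.
rewrite /mximg (_ : linfun _ = \1%VF) ?lim1g//.
by apply/lfunP => x; rewrite id_lfunE lfunE/= mul1mx.
Qed.

Lemma mximgZ (r : R) B V : r != 0 -> mximg (r *: B) V = mximg B V.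
Proof.
move=> r0; apply/eqP; rewrite eqEsubv.
apply/andP; split; apply/subvP => x /mximgP[y yV ->].
  by rewrite -scalemxAl memvZ// mem_mximg.
have -> : B *m y = (r *: B) *m (r^-1 *: y).
  by rewrite -scalemxAl -scalemxAr scalerA divff// scale1r.
by rewrite mem_mximg// memvZ.
Qed.

Lemma dim_mximg B V : B \in unitmx -> \dim (mximg B V) = \dim V.
Proof.
move=> uB; apply: limg_dim_eq.
apply/eqP; rewrite -subv0; apply/subvP => x; rewrite memv_cap memv_ker lfunE/=.
move=> /andP[_ /eqP Bx]; rewrite memv0 -[x]mul1mx -(mulVmx uB) -mulmxA Bx.
by rewrite mulmx0.
Qed.

(** The largest principal angle grows at most by a constant factor under an
    invertible matrix [P]. Its sine is the largest distance of a unit vector of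
    the first subspace to the second one, and [P] distorts distances by at most
    its norm and the norm of its inverse. *)
Lemma principal_angle_image (P : 'M[R]_d) : P \in unitmx ->
  exists2 C : R, 0 < C & forall s V W phi v w psi v' w',
    (0 < s)%N -> \dim V = s -> \dim W = s ->
    \dim (mximg P V) = s -> \dim (mximg P W) = s ->
    principal_system s V W phi v w ->
    principal_system s (mximg P V) (mximg P W) psi v' w' ->
    psi s <= C * phi s.
Proof.
move=> uP.
have [K K0 PK] := mulmx_bounded P.
have [L L0 PL] := mulmx_bounded (invmx P).
exists (2 * Num.sqrt (K * L)); first by rewrite mulr_gt0// sqrtr_gt0 mulr_gt0.
move=> s V W phi v w psi v' w' s0 dV dW dPV dPW HV HP.
have ss : (1 <= s <= s)%N by rewrite s0 leqnn.
have [/andP[ps0 ps2] [xV _ /enorm1 x1 _ _] _ _] := HP.2 _ ss.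
have [/andP[ph0 ph2] _ _ _] := HV.2 _ ss.
have [z zV xE] := memv_imgP xV; rewrite lfunE/= in xE.
have [u uW zu] := principal_near HV s0 dV zV.
have PuW : P *m u \in mximg P W.
  by apply/memv_imgP; exists u => //; rewrite lfunE.
have := principal_far HP s0 dPW PuW; rewrite xE -mulmxBr => h1.
have h2 := PK (z - u).
have h3 : dotc z z <= L.
  by have := PL (P *m z); rewrite mulKmx// -xE x1 mulr1.
have h4 : sin (psi s) ^+ 2 <= K * (sin (phi s) ^+ 2 * L).
  apply: (le_trans h1); apply: (le_trans h2); rewrite ler_wpM2l ?(ltW K0)//.
  by apply: (le_trans zu); rewrite ler_wpM2l ?sqr_ge0.
have h5 : psi s / 2 <= sin (psi s) by apply: half_le_sin; rewrite ps0.
have h6 := sin_le_id ph0.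
have h7 : 0 <= sin (phi s) by apply: le_trans (half_le_sin _); rewrite ?ph0; lra.
have h8 : (psi s / 2) ^+ 2 <= (Num.sqrt (K * L) * phi s) ^+ 2.
  rewrite [leRHS]exprMn sqr_sqrtr ?mulr_ge0 ?(ltW K0) ?(ltW L0)//.
  apply: (@le_trans _ _ (sin (psi s) ^+ 2)).
    by rewrite lerXn2r// nnegrE; lra.
  apply: (le_trans h4); rewrite mulrCA mulrC ler_wpM2l ?mulr_ge0 ?(ltW K0) ?(ltW L0)//.
  by rewrite lerXn2r ?nnegrE.
have : psi s / 2 <= Num.sqrt (K * L) * phi s.
  by rewrite -ler_sqr// nnegrE ?mulr_ge0//; lra.
lra.
Qed.

Lemma angle_mximg_le P : P \in unitmx -> exists2 c : R, 0 < c &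
  forall s V W, (0 < s)%N -> \dim V = s -> \dim W = s ->
    angle s (mximg P V) (mximg P W) <= c * angle s V W.
Proof.
move=> uP; have [c c0 h] := principal_angle_image uP.
exists c => // s V W s0 dV dW.
have dPV : \dim (mximg P V) = s by rewrite dim_mximg.
have dPW : \dim (mximg P W) = s by rewrite dim_mximg.
have [phi [v [w [S ->]]]] := angleP dV dW.
have [psi [v' [w' [S' ->]]]] := angleP dPV dPW.
exact: (h _ _ _ _ _ _ _ _ _ s0 dV dW dPV dPW S S').
Qed.

Lemma dotc_orthogonal P x y :
  orthogonalmx P -> dotc (P *m x) (P *m y) = dotc x y.
Proof.
by rewrite /dotc trmx_mul -mulmxA [P^T *m _]mulmxA => ->; rewrite mul1mx.
Qed.

(** An orthogonal matrix maps principal systems to principal systems with the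
    same angles. *)
Lemma principal_system_orthogonal s P V W phi v w : orthogonalmx P ->
  principal_system s V W phi v w ->
  principal_system s (mximg P V) (mximg P W) phi
    (fun j => P *m v j) (fun j => P *m w j).
Proof.
move=> oP [mono S]; split => // j /S[b [vV wW /enorm1 v1 /enorm1 w1 o] m c].
split => //; last by rewrite dotc_orthogonal.
- split; [exact: mem_mximg|exact: mem_mximg| | |].
  + by apply/enorm1; rewrite dotc_orthogonal.
  + by apply/enorm1; rewrite dotc_orthogonal.
  + by move=> l lj; rewrite !dotc_orthogonal//; exact: o.
- move=> _ _ [/mximgP[x xV ->] /mximgP[y yW ->] /enorm1 x1 /enorm1 y1 o'].
  rewrite !dotc_orthogonal//; apply: m; split => //.
  + by apply/enorm1; rewrite dotc_orthogonal in x1.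
  + by apply/enorm1; rewrite dotc_orthogonal in y1.
  + by move=> l lj; have := o' l lj; rewrite !dotc_orthogonal.
Qed.

Lemma angle_orthogonal s P V W : orthogonalmx P ->
  angle s (mximg P V) (mximg P W) = angle s V W.
Proof.
move=> oP; have oPT : orthogonalmx P^T by rewrite /orthogonalmx trmxK mulmx1C.
congr (xget _ _); apply/seteqP; split => t [phi [v [w [S ->]]]].
  exists phi, (fun j => P^T *m v j), (fun j => P^T *m w j); split => //.
  have := principal_system_orthogonal oPT S.
  by rewrite -!mximgM oP !mximg1.
by exists phi, (fun j => P *m v j), (fun j => P *m w j); split => //;
  exact: principal_system_orthogonal.
Qed.

End images.

(** * Fekete's lemma *)

(** Fekete's lemma for nonnegative subadditive sequences; the limit is the infimum
    of [u n / n] over positive [n]. *)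
Lemma fekete (R : realType) (u : nat -> R) :
  (forall n, 0 <= u n) -> (forall m n, u (m + n)%N <= u m + u n) ->
  cvgn (fun n => n%:R^-1 * u n).
Proof.
move=> u0 usub.
pose E := [set n.+1%:R^-1 * u n.+1 | n in [set: nat]].
have hE : has_inf E.
  split; first by exists (1%:R^-1 * u 1%N); exists 0%N.
  by exists 0 => _ [n _ <-]; rewrite mulr_ge0.
have umul m q : u (q * m)%N <= q%:R * u m + u 0%N.
  elim: q => [|q IH]; first by rewrite mul0n mul0r add0r.
  by rewrite mulSn (le_trans (usub _ _))// -natr1 mulrDl mul1r; lra.
apply/cvg_ex; exists (inf E); apply/cvgrPdist_le => /= e e0.
have e2 : 0 < e / 2 by rewrite divr_gt0.
have [_ [m _ <-] mE] := inf_adherent e2 hE.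
pose M := \sum_(i < m.+1) u i.
have M0 : 0 <= M by apply: sumr_ge0.
have uM r : (r < m.+1)%N -> u r <= M.
  move=> rm; rewrite /M (bigD1 (Ordinal rm))//= lerDl.
  by apply: sumr_ge0.
(* Divide [n] by [m.+1], where [m.+1] almost realises the infimum; the
   remainder is bounded by [M], which is negligible against [n]. *)
near=> n.
have n0 : (0 < n)%N by near: n; exists 1%N.
have nR : (0 : R) < n%:R by rewrite ltr0n.
have lo : inf E <= n%:R^-1 * u n.
  by apply: ge_inf; [exact: hE.2|exists n.-1; rewrite ?prednK].
rewrite ler0_norm ?subr_le0// opprB lerBlDl.
rewrite mulrC ler_pdivrMr//.
have hM : M + M <= (e / 2) * n%:R.
  rewrite mulrC -ler_pdivrMr//; near: n; exact: nbhs_infty_ger.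
rewrite [X in u X](divn_eq n m.+1).
apply: (le_trans (usub _ _)).
have h1 := umul m.+1 (n %/ m.+1)%N.
have h2 := uM _ (ltn_pmod n (ltn0Sn m)).
have h3 := uM 0%N (ltn0Sn m).
have h4 : (n %/ m.+1)%:R * u m.+1 <= n%:R * (m.+1%:R^-1 * u m.+1).
  rewrite mulrA ler_wpM2r// ler_pdivlMr ?ltr0n// -natrM ler_nat.
  exact: leq_trunc_div.
have h5 : n%:R * (m.+1%:R^-1 * u m.+1) <= n%:R * (inf E + e / 2).
  by rewrite ler_wpM2l// ltW.
have -> : (inf E + e) * n%:R = n%:R * (inf E + e / 2) + e / 2 * n%:R.
  by field.
have h6 := le_trans h4 h5; apply: le_trans (lerD (le_trans h1 (lerD h6 h3)) h2) _.
by rewrite -addrA lerD2l.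
Unshelve. all: by end_near. Qed.

(** * Monotonicity and homogeneity of suprema and upper limits *)

Section ereal_homogeneous.
Context {R : realType}.
Local Open Scope ereal_scope.
Implicit Types (c : R) (u v : nat -> \bar R).

Lemma ereal_sup_leZ c (X Y : set (\bar R)) : (0 < c)%R ->
  (forall x, X x -> exists2 y, Y y & x <= c%:E * y) ->
  ereal_sup X <= c%:E * ereal_sup Y.
Proof.
move=> c0 XY; apply: ge_ereal_sup => x /XY[y Yy /le_trans]; apply.
by rewrite lee_pmul2l//; exact: ereal_sup_ubound.
Qed.

Lemma ereal_inf_leZ c (X Y : set (\bar R)) : (0 < c)%R ->
  (forall y, Y y -> exists2 x, X x & x <= c%:E * y) ->
  ereal_inf X <= c%:E * ereal_inf Y.
Proof.
move=> c0 XY; rewrite -ereal_inf_pZl//.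
apply: le_ereal_inf_tmp => _ [y Yy <-]; have [x Xx] := XY _ Yy.
exact/le_trans/ereal_inf_lbound.
Qed.

Lemma limn_esup_leZ c u v : (0 < c)%R -> (forall n, u n <= c%:E * v n) ->
  limn_esup u <= c%:E * limn_esup v.
Proof.
move=> c0 uv; apply: ereal_inf_leZ => // _ [D FD <-].
exists (ereal_sup (u @` D)); first by exists D.
by apply: ereal_sup_leZ => // _ [n Dn <-]; exists (v n) => //; exists n.
Qed.

Lemma limn_einfE u :
  limn_einf u = ereal_sup [set ereal_inf (u @` D) | D in (\oo : set (set nat))].
Proof. exact: limf_einfE. Qed.

Lemma limn_einf_leZ c u v : (0 < c)%R -> (forall n, u n <= c%:E * v n) ->
  limn_einf u <= c%:E * limn_einf v.
Proof.
move=> c0 uv; rewrite !limn_einfE; apply: ereal_sup_leZ => // _ [D FD <-].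
exists (ereal_inf (v @` D)); first by exists D.
by apply: ereal_inf_leZ => // _ [n Dn <-]; exists (u n) => //; exists n.
Qed.

Lemma limn_einf_ge0 u : (forall n, 0 <= u n) -> 0 <= limn_einf u.
Proof.
move=> u0; rewrite limn_einfE; apply: le_ereal_sup_tmp.
exists (ereal_inf (u @` setT)); first by exists setT => //; exact: filterT.
by apply: le_ereal_inf_tmp => _ [n _ <-].
Qed.

Lemma limn_esup_ge0 u : (forall n, 0 <= u n) -> 0 <= limn_esup u.
Proof. by move=> u0; exact: le_trans (limn_einf_ge0 u0) (limn_einf_sup u). Qed.

Lemma ereal_sup_ge_lbound (X : set (\bar R)) b :
  X !=set0 -> (forall x, X x -> b <= x) -> b <= ereal_sup X.
Proof. by move=> [x Xx] h; apply: le_ereal_sup_tmp; exists x => //; exact: h. Qed.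

End ereal_homogeneous.

(** * Angular values *)

Section values.
Context {R : realType} {d : nat}.
Implicit Types (V W : {vspace 'cV[R]_d}) (A B : nat -> 'M[R]_d) (s n k : nat).

Lemma pi2_ge0 : 0 <= pi / 2 :> R.
Proof. by rewrite divr_ge0 ?pi_ge0. Qed.

Lemma angle_bounds s V W : (0 < s)%N -> 0 <= angle s V W <= pi / 2.
Proof.
move=> s0; rewrite /angle.
case: xgetP => [t _ [phi [v [w [[_ H] ->]]]]|_]; last by rewrite lexx pi2_ge0.
by have [|] := H s; rewrite ?s0 ?leqnn.
Qed.

Lemma angle_ge0 s V W : (0 < s)%N -> 0 <= angle s V W.
Proof. by move=> s0; have /andP[] := angle_bounds V W s0. Qed.

Lemma angle_le_pi2 s V W : (0 < s)%N -> angle s V W <= pi / 2.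
Proof. by move=> s0; have /andP[] := angle_bounds V W s0. Qed.

Lemma angle_sum_ge0 A s k n V : (0 < s)%N -> 0 <= angle_sum A s k n V.
Proof. by move=> s0; apply: sumr_ge0 => i _; exact: angle_ge0. Qed.

Lemma angle_sum_le A s k n V : (0 < s)%N ->
  angle_sum A s k n V <= n%:R * (pi / 2).
Proof.
move=> s0; rewrite /angle_sum.
have -> : n%:R * (pi / 2) = \sum_(k.+1 <= j < (k + n).+1) (pi / 2) :> R.
  by rewrite sumr_const_nat subSS addKn mulr_natl.
by apply: ler_sum => i _; exact: angle_le_pi2.
Qed.

Lemma angle_sumD A s k m n V :
  angle_sum A s k (m + n) V = angle_sum A s k m V + angle_sum A s (k + m) n V.
Proof.
by rewrite /angle_sum addnA -big_cat_nat// ltnS ?leq_addr.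
Qed.

Lemma sup_angle_sum_fin A s n V : (0 < s)%N ->
  sup_angle_sum A s n V =
  (sup (range (fun k => angle_sum A s k n V)))%:E.
Proof.
move=> s0; rewrite /sup_angle_sum.
have -> : range (fun k => (angle_sum A s k n V)%:E)
        = EFin @` range (fun k => angle_sum A s k n V) by rewrite image_comp.
apply: ereal_sup_EFin; last by exists (angle_sum A s 0 n V); exists 0%N.
by exists (n%:R * (pi / 2)) => _ [k _ <-]; exact: angle_sum_le.
Qed.

Lemma inf_angle_sum_fin A s n V : (0 < s)%N ->
  inf_angle_sum A s n V =
  (inf (range (fun k => angle_sum A s k n V)))%:E.
Proof.
move=> s0; rewrite /inf_angle_sum.
have -> : range (fun k => (angle_sum A s k n V)%:E)
        = EFin @` range (fun k => angle_sum A s k n V) by rewrite image_comp.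
apply: ereal_inf_EFin; last by exists (angle_sum A s 0 n V); exists 0%N.
by exists 0 => _ [k _ <-]; exact: angle_sum_ge0.
Qed.

Lemma sup_angle_sum_ge0 A s n V : (0 < s)%N -> (0 <= sup_angle_sum A s n V)%E.
Proof.
move=> s0; apply: ereal_sup_ge_lbound.
  by exists (angle_sum A s 0 n V)%:E; exists 0%N.
by move=> _ [k _ <-]; rewrite lee_fin angle_sum_ge0.
Qed.

Lemma inf_angle_sum_ge0 A s n V : (0 < s)%N -> (0 <= inf_angle_sum A s n V)%E.
Proof.
move=> s0; apply: le_ereal_inf_tmp => _ [k _ <-].
by rewrite lee_fin angle_sum_ge0.
Qed.

(** The suprema over [k] are subadditive in [n]. *)
Lemma cvg_sup_angle_sum A s V : (0 < s)%N ->
  cvgn (fun n => (invn n * sup_angle_sum A s n V)%E).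
Proof.
move=> s0; pose b n := sup (range (fun k => angle_sum A s k n V)).
have hs n : has_sup (range (fun k => angle_sum A s k n V)).
  split; first by exists (angle_sum A s 0 n V); exists 0%N.
  by exists (n%:R * (pi / 2)) => _ [k _ <-]; exact: angle_sum_le.
have lb n k : angle_sum A s k n V <= b n.
  by apply: ub_le_sup; [exact: (hs n).2|exists k].
have /cvg_ex[l bl] : cvgn (fun n => n%:R^-1 * b n).
  apply: fekete => [n|m n]; first exact: le_trans (angle_sum_ge0 A 0 n V s0) (lb n 0%N).
  apply: ge_sup; first exact: (hs _).1.
  by move=> _ [k _ <-]; rewrite angle_sumD lerD.
apply/cvg_ex; exists l%:E.
rewrite (_ : (fun n => _) = EFin \o (fun n => n%:R^-1 * b n)).
  by apply/fine_cvgP; split => //; exact: nearW.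
by apply/funext => n /=; rewrite sup_angle_sum_fin.
Qed.

(** The infima over [k] are superadditive in [n] and bounded by [n * (pi / 2)];
    Fekete's lemma applies to the difference. *)
Lemma cvg_inf_angle_sum A s V : (0 < s)%N ->
  cvgn (fun n => (invn n * inf_angle_sum A s n V)%E).
Proof.
move=> s0; pose b n := inf (range (fun k => angle_sum A s k n V)).
have hs n : has_inf (range (fun k => angle_sum A s k n V)).
  split; first by exists (angle_sum A s 0 n V); exists 0%N.
  by exists 0 => _ [k _ <-]; exact: angle_sum_ge0.
have lb n k : b n <= angle_sum A s k n V.
  by apply: ge_inf; [exact: (hs n).2|exists k].
have /cvg_ex[l bl] : cvgn (fun n => n%:R^-1 * (n%:R * (pi / 2) - b n)).
  apply: (@fekete _ (fun n => n%:R * (pi / 2) - b n)) => [n|m n].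
    by rewrite subr_ge0 (le_trans (lb n 0%N))// angle_sum_le.
  rewrite natrD mulrDl.
  suff : b m + b n <= b (m + n)%N by lra.
  apply: lb_le_inf; first exact: (hs _).1.
  by move=> _ [k _ <-]; rewrite angle_sumD lerD.
apply/cvg_ex; exists (pi / 2 - l)%:E.
rewrite (_ : (fun n => _) = EFin \o (fun n => n%:R^-1 * b n)); last first.
  by apply/funext => n /=; rewrite inf_angle_sum_fin.
apply/fine_cvgP; split; first exact: nearW.
have : (pi / 2 - n%:R^-1 * (n%:R * (pi / 2) - b n)) @[n --> \oo] --> pi / 2 - l.
  by apply: cvgB => //; exact: cvg_cst.
apply: cvg_trans; apply: near_eq_cvg; near=> n => /=.
rewrite mulrBr mulKf ?subKr//.
by rewrite pnatr_eq0 -lt0n; near: n; exists 1%N.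
Unshelve. all: by end_near. Qed.

(** Since the limit exists it is an upper limit, which is monotone and homogeneous
    without any convergence assumption. *)
Lemma unif_outer_supE A s : (0 < s)%N -> unif_outer_sup A s =
  ereal_sup [set limn_esup (fun n => invn n * sup_angle_sum A s n V)%E
            | V in Grass s].
Proof.
move=> s0; congr (ereal_sup _); apply: eq_imagel => V _.
by rewrite is_cvg_limn_esupE//; exact: cvg_sup_angle_sum.
Qed.

Lemma unif_outer_infE A s : (0 < s)%N -> unif_outer_inf A s =
  ereal_sup [set limn_einf (fun n => invn n * inf_angle_sum A s n V)%E
            | V in Grass s].
Proof.
move=> s0; congr (ereal_sup _); apply: eq_imagel => V _.
by rewrite is_cvg_limn_einfE//; exact: cvg_inf_angle_sum.
Qed.

Lemma invnZ_le c n (x y : \bar R) :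
  (x <= c%:E * y)%E -> (invn n * x <= c%:E * (invn n * y))%E.
Proof.
by move=> xy; rewrite muleCA lee_wpmul2l// lee_fin.
Qed.

(** If every angle sum of [B] is bounded by [c] times an angle sum of [A], for
    a subspace that depends neither on [k] nor on [n], then each angular value of
    [B] is at most [c] times that of [A]. *)
Section domination.
Variables (s : nat) (c : R) (A B : nat -> 'M[R]_d).
Hypotheses (s0 : (0 < s)%N) (c0 : 0 < c).
Hypothesis dom : forall V, Grass s V -> exists2 W, Grass s W &
    forall k n, angle_sum B s k n V <= c * angle_sum A s k n W.

Lemma inner_sup_le n :
  (invn n * ereal_sup [set (angle_sum B s 0 n V)%:E | V in Grass s] <=
  c%:E * (invn n * ereal_sup [set (angle_sum A s 0 n V)%:E | V in Grass s]))%E.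
Proof.
apply: invnZ_le; apply: ereal_sup_leZ => // _ [V /dom[W GW h] <-].
by exists (angle_sum A s 0 n W)%:E; [exists W|rewrite -EFinM lee_fin].
Qed.

Lemma sup_angle_sum_leZ V : Grass s V -> exists2 W, Grass s W &
  forall n, (sup_angle_sum B s n V <= c%:E * sup_angle_sum A s n W)%E.
Proof.
move=> /dom[W GW h]; exists W => // n.
apply: ereal_sup_leZ => // _ [k _ <-].
by exists (angle_sum A s k n W)%:E; [exists k|rewrite -EFinM lee_fin].
Qed.

Lemma inf_angle_sum_leZ V : Grass s V -> exists2 W, Grass s W &
  forall n, (inf_angle_sum B s n V <= c%:E * inf_angle_sum A s n W)%E.
Proof.
move=> /dom[W GW h]; exists W => // n.
apply: ereal_inf_leZ => // _ [k _ <-].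
by exists (angle_sum B s k n V)%:E; [exists k|rewrite -EFinM lee_fin].
Qed.

Lemma inner_limsup_leZ : (inner_limsup B s <= c%:E * inner_limsup A s)%E.
Proof. by apply: limn_esup_leZ => // n; exact: inner_sup_le. Qed.

Lemma inner_liminf_leZ : (inner_liminf B s <= c%:E * inner_liminf A s)%E.
Proof. by apply: limn_einf_leZ => // n; exact: inner_sup_le. Qed.

Lemma outer_limsup_leZ : (outer_limsup B s <= c%:E * outer_limsup A s)%E.
Proof.
apply: ereal_sup_leZ => // _ [V /dom[W GW h] <-].
eexists; first by exists W.
by apply: limn_esup_leZ => // n; apply: invnZ_le; rewrite -EFinM lee_fin.
Qed.

Lemma outer_liminf_leZ : (outer_liminf B s <= c%:E * outer_liminf A s)%E.
Proof.
apply: ereal_sup_leZ => // _ [V /dom[W GW h] <-].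
eexists; first by exists W.
by apply: limn_einf_leZ => // n; apply: invnZ_le; rewrite -EFinM lee_fin.
Qed.

Lemma unif_inner_limsup_leZ :
  (unif_inner_limsup B s <= c%:E * unif_inner_limsup A s)%E.
Proof.
apply: limn_esup_leZ => // n; apply: invnZ_le.
apply: ereal_sup_leZ => // _ [V /sup_angle_sum_leZ[W GW h] <-].
by eexists; first by exists W.
Qed.

Lemma unif_inner_liminf_leZ :
  (unif_inner_liminf B s <= c%:E * unif_inner_liminf A s)%E.
Proof.
apply: limn_einf_leZ => // n; apply: invnZ_le.
apply: ereal_sup_leZ => // _ [V /inf_angle_sum_leZ[W GW h] <-].
by eexists; first by exists W.
Qed.

Lemma unif_outer_sup_leZ : (unif_outer_sup B s <= c%:E * unif_outer_sup A s)%E.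
Proof.
rewrite !unif_outer_supE//.
apply: ereal_sup_leZ => // _ [V /sup_angle_sum_leZ[W GW h] <-].
eexists; first by exists W.
by apply: limn_esup_leZ => // n; exact: invnZ_le.
Qed.

Lemma unif_outer_inf_leZ : (unif_outer_inf B s <= c%:E * unif_outer_inf A s)%E.
Proof.
rewrite !unif_outer_infE//.
apply: ereal_sup_leZ => // _ [V /inf_angle_sum_leZ[W GW h] <-].
eexists; first by exists W.
by apply: limn_einf_leZ => // n; exact: invnZ_le.
Qed.

End domination.
End values.

Section nonneg.
Context {R : realType} {d : nat}.
Variables (A : nat -> 'M[R]_d) (s : nat).
Hypothesis hs : (1 <= s <= d)%N.

Let s0 : (0 < s)%N. Proof. by case/andP: hs. Qed.

Lemma Grass_neq0 : @Grass R d s !=set0.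
Proof.
case/andP: hs => _ sd; pose X := vbasis (fullv : {vspace 'cV[R]_d}).
have sX : size X = d by rewrite size_tuple dimvf /dim/= muln1.
exists <<take s X>>%VS; rewrite /Grass/=.
have /eqnP -> : free (take s X).
  apply: (@catl_free _ _ (drop s X)).
  by rewrite cat_take_drop (basis_free (vbasisP _)).
by rewrite size_takel// sX.
Qed.

Lemma invn_mul_ge0 n (x : \bar R) : (0 <= x)%E -> (0 <= invn n * x)%E.
Proof. by move=> x0; rewrite mule_ge0// lee_fin. Qed.

Lemma sup_Grass_ge0 (f : {vspace 'cV[R]_d} -> \bar R) :
  (forall V, (0 <= f V)%E) -> (0 <= ereal_sup [set f V | V in Grass s])%E.
Proof.
move=> f0; have [V GV] := Grass_neq0.
by apply: ereal_sup_ge_lbound => [|_ [W _ <-]//]; exists (f V); exists V.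
Qed.

Let sum0 k n V : (0 <= (angle_sum A s k n V)%:E)%E.
Proof. by rewrite lee_fin angle_sum_ge0. Qed.

Lemma inner_limsup_ge0 : (0 <= inner_limsup A s)%E.
Proof. by apply: limn_esup_ge0 => n; apply/invn_mul_ge0/sup_Grass_ge0. Qed.

Lemma inner_liminf_ge0 : (0 <= inner_liminf A s)%E.
Proof. by apply: limn_einf_ge0 => n; apply/invn_mul_ge0/sup_Grass_ge0. Qed.

Lemma outer_limsup_ge0 : (0 <= outer_limsup A s)%E.
Proof.
by apply: sup_Grass_ge0 => V; apply: limn_esup_ge0 => n; exact: invn_mul_ge0.
Qed.

Lemma outer_liminf_ge0 : (0 <= outer_liminf A s)%E.
Proof.
by apply: sup_Grass_ge0 => V; apply: limn_einf_ge0 => n; exact: invn_mul_ge0.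
Qed.

Lemma unif_inner_limsup_ge0 : (0 <= unif_inner_limsup A s)%E.
Proof.
apply: limn_esup_ge0 => n; apply/invn_mul_ge0/sup_Grass_ge0 => V.
exact: sup_angle_sum_ge0.
Qed.

Lemma unif_inner_liminf_ge0 : (0 <= unif_inner_liminf A s)%E.
Proof.
apply: limn_einf_ge0 => n; apply/invn_mul_ge0/sup_Grass_ge0 => V.
exact: inf_angle_sum_ge0.
Qed.

Lemma unif_outer_sup_ge0 : (0 <= unif_outer_sup A s)%E.
Proof.
rewrite unif_outer_supE//; apply: sup_Grass_ge0 => V.
by apply: limn_esup_ge0 => n; apply: invn_mul_ge0; exact: sup_angle_sum_ge0.
Qed.

Lemma unif_outer_inf_ge0 : (0 <= unif_outer_inf A s)%E.
Proof.
rewrite unif_outer_infE//; apply: sup_Grass_ge0 => V.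
by apply: limn_einf_ge0 => n; apply: invn_mul_ge0; exact: inf_angle_sum_ge0.
Qed.

End nonneg.

(** * The transformed system *)

Section transformation.
Context {R : realType} {d : nat}.
Variables (A Q : nat -> 'M[R]_d).
Hypotheses (hA : forall n, A n \in unitmx) (hQ : forall n, Q n \in unitmx).

Lemma Phi_unit n : Phi A n \in unitmx.
Proof. by elim: n => [|n IH] /=; rewrite ?unitmx1// unitmx_mul hA. Qed.

Lemma Phi_transformed n :
  Phi (transformed Q A) n = Q n *m Phi A n *m invmx (Q 0%N).
Proof.
elim: n => [|n IH] /=; first by rewrite mulmx1 mulmxV.
by rewrite IH /transformed !mulmxA mulmxKV.
Qed.

Variables (r : nat -> R) (P : 'M[R]_d).
Hypotheses (r0 : forall n, r n != 0) (QE : forall n, Q n = r n *: P).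

(** The transformed orbit of [V] is the image under [P] of the original orbit of
    [Q_0^-1 V]; the scalars [r n] do not affect subspaces. *)
Lemma angle_sum_transformed s k n V :
  angle_sum (transformed Q A) s k n V =
  \sum_(k.+1 <= j < (k + n).+1)
    angle s (mximg P (mximg (Phi A j.-1) (mximg (invmx (Q 0%N)) V)))
            (mximg P (mximg (Phi A j) (mximg (invmx (Q 0%N)) V))).
Proof.
apply: eq_bigr => j _; rewrite !Phi_transformed !mximgM.
by rewrite (QE j.-1) (QE j) !mximgZ.
Qed.

Lemma angle_sum_transformed_orthogonal s k n V : orthogonalmx P ->
  angle_sum (transformed Q A) s k n V =
  angle_sum A s k n (mximg (invmx (Q 0%N)) V).
Proof.
move=> oP; rewrite angle_sum_transformed; apply: eq_bigr => j _.
exact: angle_orthogonal.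
Qed.

Lemma angle_sum_transformed_le : exists2 c : R, 0 < c &
  forall s k n V, (0 < s)%N -> \dim V = s ->
  angle_sum (transformed Q A) s k n V <=
  c * angle_sum A s k n (mximg (invmx (Q 0%N)) V).
Proof.
have uP : P \in unitmx.
  by have := hQ 0%N; rewrite QE unitmxZ// unitfE.
have [c c0 h] := angle_mximg_le uP; exists c => // s k n V s0 dV.
rewrite angle_sum_transformed mulr_sumr; apply: ler_sum => j _.
by apply: h => //; rewrite !dim_mximg ?unitmx_inv ?Phi_unit.
Qed.

End transformation.

Lemma eq_of_le1 (R : realType) (x y : \bar R) :
  (x <= 1%:E * y -> y <= 1%:E * x -> x = y)%E.
Proof. by rewrite !mul1e => xy yx; apply/eqP; rewrite eq_le xy. Qed.

Lemma eq0_of_leZ (R : realType) (c : R) (x y : \bar R) :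
  (0 <= y -> y <= c%:E * x -> x = 0 -> y = 0)%E.
Proof.
by move=> y0 yx x0; apply/eqP; rewrite eq_le y0 andbT -(mule0 c%:E) -x0.
Qed.

Theorem proposition3p8 (R : realType) (d s : nat) (A Q : nat -> 'M[R]_d)
    (hA : forall n, A n \in unitmx) (hQ : forall n, Q n \in unitmx)
    (hs : (1 <= s <= d)%N) :
  (forall (r : nat -> R) (P : 'M[R]_d),
     (forall n, r n != 0) -> orthogonalmx P -> (forall n, Q n = r n *: P) ->
     unif_outer_inf (transformed Q A) s = unif_outer_inf A s /\
     outer_liminf (transformed Q A) s = outer_liminf A s /\
     outer_limsup (transformed Q A) s = outer_limsup A s /\
     unif_outer_sup (transformed Q A) s = unif_outer_sup A s /\
     unif_inner_liminf (transformed Q A) s = unif_inner_liminf A s /\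
     inner_liminf (transformed Q A) s = inner_liminf A s /\
     inner_limsup (transformed Q A) s = inner_limsup A s /\
     unif_inner_limsup (transformed Q A) s = unif_inner_limsup A s) /\
  (forall P : 'M[R]_d,
     P \in unitmx -> (forall n, Q n = P) ->
     (unif_outer_inf A s = 0%E -> unif_outer_inf (transformed Q A) s = 0%E) /\
     (outer_liminf A s = 0%E -> outer_liminf (transformed Q A) s = 0%E) /\
     (outer_limsup A s = 0%E -> outer_limsup (transformed Q A) s = 0%E) /\
     (unif_outer_sup A s = 0%E -> unif_outer_sup (transformed Q A) s = 0%E) /\
     (unif_inner_liminf A s = 0%E -> unif_inner_liminf (transformed Q A) s = 0%E) /\
     (inner_liminf A s = 0%E -> inner_liminf (transformed Q A) s = 0%E) /\
     (inner_limsup A s = 0%E -> inner_limsup (transformed Q A) s = 0%E) /\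
     (unif_inner_limsup A s = 0%E -> unif_inner_limsup (transformed Q A) s = 0%E)).
Proof.
have s0 : (0 < s)%N by case/andP: hs.
split=> [r P r0 oP QE|P uP QE].
  (* The two systems dominate each other with constant 1. *)
  have toA V : Grass s V -> exists2 W, Grass s W & forall k n,
      angle_sum (transformed Q A) s k n V <= 1 * angle_sum A s k n W.
    move=> GV; exists (mximg (invmx (Q 0%N)) V) => [|k n].
      by rewrite /Grass/= dim_mximg// unitmx_inv.
    by rewrite mul1r (angle_sum_transformed_orthogonal _ hQ r0 QE).
  have ofA V : Grass s V -> exists2 W, Grass s W & forall k n,
      angle_sum A s k n V <= 1 * angle_sum (transformed Q A) s k n W.
    move=> GV; exists (mximg (Q 0%N) V) => [|k n].
      by rewrite /Grass/= dim_mximg.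
    rewrite mul1r (angle_sum_transformed_orthogonal _ hQ r0 QE)//.
    by rewrite -mximgM mulVmx// mximg1.
  do !apply: conj; apply: eq_of_le1.
  - exact: unif_outer_inf_leZ.
  - exact: unif_outer_inf_leZ.
  - exact: outer_liminf_leZ.
  - exact: outer_liminf_leZ.
  - exact: outer_limsup_leZ.
  - exact: outer_limsup_leZ.
  - exact: unif_outer_sup_leZ.
  - exact: unif_outer_sup_leZ.
  - exact: unif_inner_liminf_leZ.
  - exact: unif_inner_liminf_leZ.
  - exact: inner_liminf_leZ.
  - exact: inner_liminf_leZ.
  - exact: inner_limsup_leZ.
  - exact: inner_limsup_leZ.
  - exact: unif_inner_limsup_leZ.
  - exact: unif_inner_limsup_leZ.
have QE1 n : Q n = (fun=> 1) n *: P by rewrite scale1r.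
have [c c0 h] := angle_sum_transformed_le hA hQ (fun=> oner_neq0 R) QE1.
have toA V : Grass s V -> exists2 W, Grass s W & forall k n,
    angle_sum (transformed Q A) s k n V <= c * angle_sum A s k n W.
  move=> GV; exists (mximg (invmx (Q 0%N)) V) => [|k n]; last exact: h.
  by rewrite /Grass/= dim_mximg// unitmx_inv.
do !apply: conj; apply: (@eq0_of_leZ _ c).
- exact: unif_outer_inf_ge0.
- exact: unif_outer_inf_leZ.
- exact: outer_liminf_ge0.
- exact: outer_liminf_leZ.
- exact: outer_limsup_ge0.
- exact: outer_limsup_leZ.
- exact: unif_outer_sup_ge0.
- exact: unif_outer_sup_leZ.
- exact: unif_inner_liminf_ge0.
- exact: unif_inner_liminf_leZ.
- exact: inner_liminf_ge0.
- exact: inner_liminf_leZ.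
- exact: inner_limsup_ge0.
- exact: inner_limsup_leZ.
- exact: unif_inner_limsup_ge0.
- exact: unif_inner_limsup_leZ.
Qed.
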